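(* For every integer $n\ge 4$, the eccentricity matrix $E(W_n)$ of the wheel graph $W_n$ on $n$ vertices is irreducible.
   Context: A square matrix $A$ of order $n$ is irreducible if there is no permutation matrix $P$ of order $n$ such that $P'AP=\begin{bmatrix}A_1&A_2\\0&A_3\end{bmatrix}$, where $A_1$ and $A_3$ are square matrices of order at least one (the prime denotes transpose). For a simple connected graph $G$ with vertices $v_1,\dots,v_n$, let $d(v_i,v_j)$ be the length of a shortest path between $v_i$ and $v_j$, and let $e(v_i)=\max\{d(v_i,v_j):1\le j\le n\}$ be the eccentricity of $v_i$. The eccentricity matrix $E(G)$ is the $n\times n$ real matrix with $(E(G))_{ij}=d(v_i,v_j)$ if $d(v_i,v_j)=\min\{e(v_i),e(v_j)\}$, and $(E(G))_{ij}=0$ otherwise. For $n\ge 4$, the wheel graph $W_n$ is the graph on $n$ vertices consisting of a cycle of length $n-1$ together with one further vertex (the hub) adjacent to every vertex of the cycle. The vertices are labelled so that $v_1$ is the hub and $v_2,\dots,v_n$ are the cycle vertices in cyclic order. *)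

(* Defs.v *)
From mathcomp Require Import all_boot all_algebra.
From mathcomp Require Import reals.

Set Implicit Arguments.
Unset Strict Implicit.
Unset Printing Implicit Defensive.

Import GRing.Theory.

Record connected_graph (n : nat) := ConnectedGraph {
  adj :> rel 'I_n;
  adj_sym : symmetric adj;
  adj_irr : irreflexive adj;
  adj_conn : forall x y, connect adj x y
}.

Section Eccentricity.

Variables (n : nat) (G : connected_graph n).

Definition has_path_of_length (x y : 'I_n) (k : nat) : bool :=
  [exists p : k.-tuple 'I_n,
    [&& path G x p, last x p == y & uniq (x :: p)]].

(* The search range [0, n) is exhaustive: a path on n vertices has fewer than
   n edges, and one from x to y exists because G is connected. *)
Definition gdist (x y : 'I_n) : nat :=
  find (has_path_of_length x y) (iota 0 n).

Definition ecc (x : 'I_n) : nat := \max_(y < n) gdist x y.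

Local Open Scope ring_scope.

Definition ecc_mx (R : realType) : 'M[R]_n :=
  \matrix_(i, j)
    (if gdist i j == minn (ecc i) (ecc j) then (gdist i j)%:R else 0).

End Eccentricity.

Lemma gdist_spec n (G : connected_graph n) (x y : 'I_n) :
  has_path_of_length G x y (gdist G x y) /\
  (forall k, has_path_of_length G x y k -> gdist G x y <= k).
Proof.
have lt_n k : has_path_of_length G x y k -> k < n.
  move=> /existsP[p /and3P[_ _ /card_uniqP]].
  rewrite /= size_tuple => <-.
  by apply: leq_trans (max_card _) _; rewrite card_ord.
have has_d : has (has_path_of_length G x y) (iota 0 n).
  have /connectP[p Gp ->] := adj_conn G x y.
  case/shortenP: Gp => q Gq Uq _.
  have Hq : has_path_of_length G x (last x q) (size q).
    by apply/existsP; exists (in_tuple q); rewrite Gq eqxx Uq.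
  apply/hasP; exists (size q) => //; rewrite mem_iota add0n /=.
  have /card_uniqP /= <- := Uq.
  by apply: leq_trans (max_card _) _; rewrite card_ord.
have lt_d : gdist G x y < n by move: has_d; rewrite has_find size_iota.
split; first by have := nth_find 0 has_d; rewrite nth_iota.
move=> k Hk; rewrite leqNgt; apply/negP => ltk.
have := before_find 0 ltk; rewrite nth_iota ?(ltn_trans ltk) // add0n.
by rewrite Hk.
Qed.

(* Vertex v_(i+1) is the ordinal of value i: the hub is 0 and the cycle is
   1, 2, ..., n-1 in this cyclic order. *)
Definition cycle_next (n : nat) (i j : 'I_n) : bool :=
  (0 < i) && ((j == i.+1 :> nat) || (i == n.-1 :> nat) && (j == 1 :> nat)).

(* The test i != j only matters for n = 2, where the cycle would be a loop. *)
Definition wheel_adj (n : nat) : rel 'I_n := fun i j =>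
  (i != j) && [|| i == 0 :> nat, j == 0 :> nat, cycle_next i j | cycle_next j i].

Lemma wheel_adj_sym n : symmetric (@wheel_adj n).
Proof.
move=> i j; rewrite /wheel_adj eq_sym.
by rewrite orbCA (orbC (cycle_next i j)).
Qed.

Lemma wheel_adj_irr n : irreflexive (@wheel_adj n).
Proof. by move=> i; rewrite /wheel_adj eqxx. Qed.

Lemma wheel_adj_conn n (i j : 'I_n) : connect (@wheel_adj n) i j.
Proof.
have n_gt0 : 0 < n by apply: leq_ltn_trans (ltn_ord i).
pose h := Ordinal n_gt0.
have to_hub k : connect (@wheel_adj n) k h.
  have [-> //|neq_kh] := eqVneq k h.
  by apply: connect1; rewrite /wheel_adj neq_kh orbT.
by rewrite (connect_trans (to_hub i)) // (sym_connect_sym (@wheel_adj_sym n)).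
Qed.

Definition wheel (n : nat) : connected_graph n :=
  ConnectedGraph (@wheel_adj_sym n) (@wheel_adj_irr n) (@wheel_adj_conn n).

Section Irreducible.

Local Open Scope ring_scope.

Definition block_triangularizable (R : nzRingType) (n : nat) (A P : 'M[R]_n)
    : Prop :=
  exists (p q : nat) (epq : (p + q)%N = n)
         (A1 : 'M[R]_p) (A2 : 'M[R]_(p, q)) (A3 : 'M[R]_q),
    [/\ (1 <= p)%N, (1 <= q)%N &
        P^T *m A *m P = castmx (epq, epq) (block_mx A1 A2 0 A3)].

Definition irreducible_mx (R : nzRingType) (n : nat) (A : 'M[R]_n) : Prop :=
  ~ exists P : 'M[R]_n, is_perm_mx P /\ block_triangularizable A P.

End Irreducible.

(* Main.v *)
Require Import Defs.
From mathcomp Require Import all_boot all_algebra.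
From mathcomp Require Import reals.
From mathcomp Require Import fingroup perm.

(** The hub has eccentricity 1, so it is at distance exactly
    [min (e(hub), e(v)) = 1] from every other vertex [v]: off the diagonal, the
    row and the column of the hub in [E(W_n)] consist of ones.  The zero block
    of a reducible matrix has index set [T x S] with [S], [T] nonempty and
    complementary; the hub lies in [S] or in [T], so its column or its row
    meets that block off the diagonal. *)

Set Implicit Arguments.
Unset Strict Implicit.
Unset Printing Implicit Defensive.

Import GRing.Theory.
Local Open Scope ring_scope.

Lemma irreducible_mx_full_cross (R : nzRingType) (n : nat) (A : 'M[R]_n)
    (h : 'I_n) :
  (forall j, j != h -> A h j != 0) -> (forall i, i != h -> A i h != 0) ->
  irreducible_mx A.
Proof.
move=> row_h col_h [P [/is_perm_mxP[s ->]]].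
move=> [p [q [epq [A1 [A2 [A3 [p_gt0 q_gt0]]]]]]].
(* Writing [s] as a double inverse lets [col_permE] apply: the conjugate has entries
   [A (s^-1 i) (s^-1 j)], so [h] sits at position [s h]. *)
subst n; rewrite castmx_id tr_perm_mx -row_permE -[s in perm_mx s]invgK.
rewrite -col_permE => blkA.
have A0 (i : 'I_q) (j : 'I_p) : A (s^-1 (rshift p i))%g (s^-1 (lshift q j))%g = 0.
  by move/matrixP/(_ (rshift p i) (lshift q j)): blkA; rewrite block_mxEdl !mxE.
rewrite -(permK s h) in row_h col_h.
case: (split_ordP (s h)) => [j|i] sh; rewrite sh in row_h col_h.
(* Any row of the lower block serves as witness; it differs from [s h], which lies in the upper
   range. *)
- have /eqP := A0 (Ordinal q_gt0) j; apply/negP/col_h.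
  by rewrite (inj_eq perm_inj) eq_rlshift.
- have /eqP := A0 i (Ordinal p_gt0); apply/negP/row_h.
  by rewrite (inj_eq perm_inj) eq_lrshift.
Qed.

Section Distance.

Variables (n : nat) (G : connected_graph n).

Lemma gdist_refl (x : 'I_n) : gdist G x x = 0%N.
Proof.
have [_ min_d] := gdist_spec G x x.
apply/eqP; rewrite -leqn0; apply: min_d.
by apply/existsP; exists [tuple]; rewrite /= eqxx.
Qed.

Lemma gdist_adj (x y : 'I_n) : G x y -> gdist G x y = 1%N.
Proof.
move=> Gxy; have neq_xy : x != y by apply: contraTneq Gxy => ->; rewrite adj_irr.
have [has_d min_d] := gdist_spec G x y.
have d_le1 : (gdist G x y <= 1)%N.
  apply: min_d; apply/existsP; exists [tuple y].
  by rewrite /= Gxy eqxx inE neq_xy.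
(* Distance 0 would give an empty path, hence [x = y]. *)
case: (gdist G x y) has_d d_le1 => [|[|//]] // /existsP[p].
by rewrite tuple0 /= (negbTE neq_xy).
Qed.

Lemma leq_gdist_ecc (x y : 'I_n) : (gdist G x y <= ecc G x)%N.
Proof. exact: (leq_bigmax y). Qed.

Lemma ecc_mx_universal_row (R : realType) (h y : 'I_n) :
  (forall z, z != h -> G h z) -> y != h -> ecc_mx G R h y = 1.
Proof.
move=> Gh neq_yh; have Ghy := Gh y neq_yh.
(* The neighbour [y] supplies the lower bound. *)
have ecc_h : ecc G h = 1%N.
  apply/eqP; rewrite eqn_leq -{2}(gdist_adj Ghy) leq_gdist_ecc andbT.
  apply/bigmax_leqP => z _; have [->|/Gh/gdist_adj->//] := eqVneq z h.
  by rewrite gdist_refl.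
have ecc_y : (1 <= ecc G y)%N.
  by rewrite -(@gdist_adj y h) ?leq_gdist_ecc // adj_sym.
by rewrite mxE gdist_adj // ecc_h (minn_idPl ecc_y) eqxx.
Qed.

(** Reduces to the row case: both distances between [h] and [x] are 1, and the minimum is
    symmetric. *)
Lemma ecc_mx_universal_col (R : realType) (h x : 'I_n) :
  (forall z, z != h -> G h z) -> x != h -> ecc_mx G R x h = 1.
Proof.
move=> Gh neq_xh; have Ghx := Gh x neq_xh.
rewrite -(ecc_mx_universal_row R Gh neq_xh) !mxE minnC.
by rewrite (gdist_adj Ghx) gdist_adj // adj_sym.
Qed.

End Distance.

Theorem proposition2p3 (R : realType) (n : nat) (hn : (4 <= n)%N) :
  irreducible_mx (ecc_mx (wheel n) R).
Proof.
pose h := Ordinal (leq_trans (isT : (0 < 4)%N) hn).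
have wheel_h z : z != h -> wheel n h z by rewrite /= /wheel_adj eq_sym => ->.
apply: (@irreducible_mx_full_cross _ _ _ h) => x neq_xh.
- by rewrite ecc_mx_universal_row ?oner_neq0.
- by rewrite ecc_mx_universal_col ?oner_neq0.
Qed.
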